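(* Let $(r_j)_{j\ge1}$ and $(n_j)_{j\ge1}$ be sequences of integers with $1\le r_j<n_j-1$ for all $j$, such that $\lim_{j\to\infty} r_j=\infty$ and $\lim_{j\to\infty}\frac{r_j}{n_j}=1$. Then the limit points of the zeros of the polynomials $\{B_{r_j,n_j}(z)\}_{j=1}^\infty$ are precisely the points of the line $\operatorname{Re} z=-\frac12$.
   Context: For integers $1\le r\le n$, $B_{r,n}(z)=\sum_{k=0}^r\binom{n}{k}z^k$, $z\in\mathbb{C}$. A point $\zeta\in\mathbb{C}$ (finite) is a limit point of the zeros of a sequence of polynomials $\{p_j\}$ if there are indices $j_1<j_2<\cdots$ and zeros $z_i$ of $p_{j_i}$ with $z_i\to\zeta$. *)

(* Defs.v *)
From HB Require Import structures.
From mathcomp Require Import all_boot all_order all_algebra.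
From mathcomp Require Import all_classical all_reals all_analysis.
From mathcomp Require Import complex.

Set Implicit Arguments.
Unset Strict Implicit.
Unset Printing Implicit Defensive.

Import Order.TTheory GRing.Theory Num.Theory numFieldNormedType.Exports.

Local Open Scope classical_set_scope.
Local Open Scope ring_scope.

Definition truncated_binomial (R : realType) (r n : nat) : {poly R[i]} :=
  \sum_(0 <= k < r.+1) 'C(n, k)%:R *: 'X^k.

(* Along a subsequence of indices, one zero is chosen from each polynomial; a
   limit point is thus a subsequential limit, not a limit along the full
   sequence. The cast to R[i]^o, which is convertible to R[i], selects the
   topology given by the complex modulus. *)
Definition zeros_limit_points (R : realType) (p : nat -> {poly R[i]}) :
    set R[i] :=
  [set zeta | exists (j : nat -> nat) (z : nat -> R[i]),
    [/\ {homo j : a b / (a < b)%N},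
        forall i, root (p (j i)) (z i)
      & z @ \oo --> (zeta : R[i]^o)]].

(* Main.v *)
(** Write [y = 1 + z], so that the line [Re z = -1/2] is [|z| = |y|].

    Left of the line ([|y| <= |z|]), [B_{r,n}(z)] is [- C(n-1,r) z^(r+1)] up to
    an error of at most [C(n-1,r) |z|^r |y|] (an Eneström-Kakeya type estimate);
    hence no zero satisfies [|z| > |y|].  Right of it, if [|z| <= rho |y|] with
    [rho < 1], then [B_{r,n}(z)] is [y^n] up to a relative error
    [2^(n-r) rho^r T] with [T = sum_{k > r} C(n,k)].  As [r/n -> 1], the numbers
    [T] and [2^(n-r)] grow subexponentially in [n], so this error tends to [0]
    and zeros cannot accumulate there.

    Conversely [(1/n) log |B_{r,n}|] tends to [max(log |z|, log |1+z|)], which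
    has a kink of order [h] across the line, while the second difference at
    step [h] of [log |p|] is at most of order [h^2 / delta^2] per root when the
    roots of [p] stay at distance [delta].  Comparing [B(c+h) B(c-h)] with
    [B(c)^2] for [h] small and real thus forces a zero near every point [c] of
    the line. *)

Require Import Defs.
From HB Require Import structures.
From mathcomp Require Import all_boot all_order all_algebra.
From mathcomp Require Import all_classical all_reals all_analysis.
From mathcomp Require Import complex.
From mathcomp Require Import ring lra.

Set Implicit Arguments.
Unset Strict Implicit.
Unset Printing Implicit Defensive.

Import Order.TTheory GRing.Theory Num.Theory numFieldNormedType.Exports.

Local Open Scope classical_set_scope.
Local Open Scope ring_scope.

Local Notation "|[ z ]|" := (Normc.normc z).

(** * Exponential growth against binomial tails *)

Lemma bernoulli_ineq (R : realDomainType) (x : R) (n : nat) :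
  0 <= x -> 1 + n%:R * x <= (1 + x) ^+ n.
Proof.
move=> x0; elim: n => [|n IH]; first by rewrite expr0 mul0r addr0.
rewrite exprS; apply: le_trans (ler_wpM2l _ IH); last lra.
have nx : 0 <= n%:R * x * x by rewrite !mulr_ge0 ?ler0n.
by rewrite -natr1; lra.
Qed.

Lemma expr_unbounded (R : realType) (K mu : R) :
  1 < mu -> exists m : nat, forall n : nat, (m <= n)%N -> K < mu ^+ n.
Proof.
move=> mu1; have d0 : 0 < mu - 1 by lra.
set m := Num.Def.archi_bound (`|K| / (mu - 1)); exists m => n mn.
have Km : `|K| / (mu - 1) < m%:R by apply: archi_boundP; rewrite divr_ge0 // ltW.
have := bernoulli_ineq m (ltW d0); rewrite addrC [1 + _]addrC subrK => b.
have {}b : K < mu ^+ m.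
  apply: lt_le_trans b; rewrite ltr_pdivrMr // in Km.
  by have := ler_norm K; lra.
by apply: lt_le_trans b _; rewrite ler_eXn2l.
Qed.

(** Since [x <= 1], each [k > r] has [x ^+ (n - r) <= x ^+ (n - k)], so the left side is dominated
    by part of the binomial expansion of [(x + 1) ^+ n]. *)
Lemma binomial_tail_bound (R : realType) (x : R) (r n : nat) :
  0 < x <= 1 -> (r <= n)%N ->
  x ^+ (n - r) * (\sum_(r.+1 <= k < n.+1) 'C(n, k))%:R <= (1 + x) ^+ n.
Proof.
move=> /andP[x0 x1] rn.
have -> : (1 + x) ^+ n = \sum_(0 <= k < n.+1) x ^+ (n - k) * 'C(n, k)%:R.
  rewrite addrC exprDn big_mkord; apply: eq_bigr => i _.
  by rewrite expr1n mulr1 mulr_natr.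
rewrite natr_sum mulr_sumr [leRHS](@big_cat_nat _ _ _ r.+1) //=.
rewrite -[leLHS]add0r lerD //.
  by apply: sumr_ge0 => i _; rewrite mulr_ge0 ?exprn_ge0 ?ler0n // ltW.
rewrite big_nat_cond [leRHS]big_nat_cond; apply: ler_sum => k /andP[/andP[rk kn] _].
rewrite ler_wpM2r ?ler0n //; apply: ler_wiXn2l => //; first exact: ltW.
by apply: leq_sub2l; apply: ltnW.
Qed.

(** With [x] small, [mu = 1 + x] and [mu ^+ 3 <= lam], the left side splits into [K],
    [(L / x) ^+ (n - r)] and [x ^+ (n - r)] times the tail; each is at most [mu ^+ n]. *)
Lemma binomial_tail_subexponential (R : realType) (K L lam : R) :
  0 <= K -> 1 <= L -> 1 < lam ->
  exists m N : nat, forall r n : nat, (r <= n)%N -> (m * (n - r) <= n)%N ->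
    (N <= n)%N ->
    K * L ^+ (n - r) * (\sum_(r.+1 <= k < n.+1) 'C(n, k))%:R < lam ^+ n.
Proof.
move=> K0 L1 lam1.
(* The 7 comes from [(1 + x) ^+ 3 <= 1 + 7 * x] on [[0, 1]]. *)
pose x := Num.min 1 ((lam - 1) / 7); pose mu := 1 + x.
have x0 : 0 < x by rewrite lt_min ltr01 /= divr_gt0 // subr_gt0.
have x1 : x <= 1 by rewrite ge_min lexx.
have xl : x <= (lam - 1) / 7 by rewrite ge_min lexx orbT.
have mu1 : 1 < mu by rewrite /mu; lra.
have mu0 : 0 < mu by lra.
have mulam : mu ^+ 3 <= lam.
  have : mu ^+ 3 <= 1 + 7 * x; last by lra.
  by rewrite /mu; nra.
have [m hm] := expr_unbounded (L / x) mu1.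
have [N hN] := expr_unbounded K mu1.
exists m, N => r n rn mn Nn.
set T := (_ : nat)%:R; set d := (n - r)%N.
have T0 : 0 <= T by rewrite ler0n.
have Tle : x ^+ d * T <= mu ^+ n by apply: binomial_tail_bound; rewrite ?x0.
have Ld : (L / x) ^+ d <= mu ^+ n.
  apply: (@le_trans _ _ (mu ^+ (m * d))); last by rewrite ler_eXn2l.
  rewrite exprM; apply: lerXn2r; rewrite ?nnegrE.
  - by rewrite divr_ge0 ?ltW //; lra.
  - by rewrite exprn_ge0 // ltW.
  - exact/ltW/hm.
have -> : K * L ^+ d * T = K * ((L / x) ^+ d * (x ^+ d * T)).
  rewrite expr_div_n [_ / _ * (_ * _)]mulrA divfK ?mulrA //.
  by rewrite expf_neq0 // gt_eqF.
have M0 : 0 < mu ^+ n by rewrite exprn_gt0.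
apply: (@lt_le_trans _ _ (mu ^+ n * (mu ^+ n * mu ^+ n))); last first.
  rewrite -!exprMn; apply: lerXn2r; rewrite ?nnegrE.
  - by rewrite !mulr_ge0 // ltW.
  - lra.
  - by move: mulam; rewrite !exprS expr0 mulr1.
apply: (@le_lt_trans _ _ (K * (mu ^+ n * mu ^+ n))); last first.
  by rewrite ltr_pM2r ?mulr_gt0 //; exact: hN.
apply: ler_wpM2l => //; apply: ler_pM => //.
  by rewrite exprn_ge0 // divr_ge0 ?ltW //; lra.
by rewrite mulr_ge0 // exprn_ge0 // ltW.
Qed.

(** * The real-valued modulus on [R[i]] *)

Lemma normc_ge0 (R : rcfType) (z : R[i]) : 0 <= |[z]|.
Proof. by case: z => a b; exact: sqrtr_ge0. Qed.

Lemma normcX (R : rcfType) (z : R[i]) (n : nat) : |[z ^+ n]| = |[z]| ^+ n.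
Proof.
elim: n => [|n IH]; first by rewrite !expr0 Normc.normc1.
by rewrite !exprS Normc.normcM IH.
Qed.

Lemma normc_nat (R : rcfType) (n : nat) : |[n%:R : R[i]]| = n%:R.
Proof. by rewrite normcMn Normc.normc1. Qed.

Lemma ler_normcD (R : rcfType) (x y : R[i]) : |[x + y]| <= |[x]| + |[y]|.
Proof. exact: le_normcD. Qed.

Lemma normcB_sym (R : rcfType) (x y : R[i]) : |[x - y]| = |[y - x]|.
Proof. by rewrite -(normcN (y - x)) opprB. Qed.

Lemma ler_normcB (R : rcfType) (x y : R[i]) : |[x]| - |[y]| <= |[x - y]|.
Proof. by rewrite lerBlDr -{1}(subrK y x) ler_normcD. Qed.

Lemma ler_normc_sum (R : rcfType) (I : eqType) (s : seq I) (F : I -> R[i]) :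
  |[\sum_(i <- s) F i]| <= \sum_(i <- s) |[F i]|.
Proof.
elim: s => [|a s IH]; first by rewrite !big_nil Normc.normc0.
rewrite !big_cons; apply: le_trans (ler_normcD _ _) _; exact: lerD.
Qed.

Lemma sqr_normcE (R : rcfType) (z : R[i]) :
  |[z]| ^+ 2 = complex.Re z ^+ 2 + complex.Im z ^+ 2.
Proof. by case: z => a b /=; rewrite sqr_sqrtr // addr_ge0 ?sqr_ge0. Qed.

Lemma normc_eq (R : rcfType) (z w : R[i]) : |[z]| ^+ 2 = |[w]| ^+ 2 -> |[z]| = |[w]|.
Proof. by move/eqP; rewrite eqrXn2 ?normc_ge0 // => /eqP. Qed.

(** * Size of the truncated binomial on either side of the line *)

Lemma horner_truncated_binomial (R : realType) (r n : nat) (z : R[i]) :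
  (truncated_binomial R r n).[z] = \sum_(0 <= k < r.+1) 'C(n, k)%:R * z ^+ k.
Proof.
rewrite /truncated_binomial horner_sum.
by apply: eq_bigr => k _; rewrite hornerZ hornerXn.
Qed.

(** Pascal's rule; raising [r] and [n] together is what makes the induction in
    [truncated_binomial_approx] close. *)
Lemma truncated_binomial_rec (R : realType) (r n : nat) (z : R[i]) :
  (truncated_binomial R r.+1 n.+1).[z] =
  (1 + z) * (truncated_binomial R r n).[z] + 'C(n, r.+1)%:R * z ^+ r.+1.
Proof.
rewrite !horner_truncated_binomial mulrDl mul1r addrAC -big_nat_recr //=.
rewrite big_nat_recl // [X in _ = X + _]big_nat_recl // -addrA !bin0.
congr (_ + _); rewrite mulr_sumr -big_split /=.
by apply: eq_bigr => k _; rewrite binS natrD exprS; ring.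
Qed.

(** By the recursion, the error at [r.+1] is [1 + z] times the sum of ['C(m, r.+1) z^(r+1)] and the
    error at [r]. The hypothesis [|1 + z| <= |z|] bounds the latter by ['C(m, r) |z|^(r+1)], and
    Pascal's rule adds the two coefficients. *)
Lemma truncated_binomial_approx (R : realType) (r m : nat) (z : R[i]) :
  (r <= m)%N -> |[1 + z]| <= |[z]| ->
  |[(truncated_binomial R r m.+1).[z] + 'C(m, r)%:R * z ^+ r.+1]|
    <= 'C(m, r)%:R * |[z]| ^+ r * |[1 + z]|.
Proof.
move=> rm yz; elim: r m rm => [m _|r IH [//|m] rm].
  rewrite horner_truncated_binomial big_nat1 !bin0 !expr0 expr1 !mul1r.
  by [].
rewrite truncated_binomial_rec.
have -> : (1 + z) * (truncated_binomial R r m.+1).[z] +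
    'C(m.+1, r.+1)%:R * z ^+ r.+1 + 'C(m.+1, r.+1)%:R * z ^+ r.+2 =
    (1 + z) * ('C(m, r.+1)%:R * z ^+ r.+1 +
     ((truncated_binomial R r m.+1).[z] + 'C(m, r)%:R * z ^+ r.+1)).
  by rewrite binS natrD !exprS; ring.
rewrite Normc.normcM mulrC ler_wpM2r ?normc_ge0 //.
apply: le_trans (ler_normcD _ _) _.
rewrite binS natrD mulrDl lerD ?Normc.normcM ?normcX ?normc_nat //.
apply: le_trans (IH m rm) _; rewrite exprSr mulrA ler_wpM2l //.
by rewrite mulr_ge0 ?exprn_ge0 ?normc_ge0.
Qed.

Lemma truncated_binomial_root (R : realType) (r n : nat) (z : R[i]) :
  (r < n)%N -> root (truncated_binomial R r n) z -> |[z]| <= |[1 + z]|.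
Proof.
case: n => [//|m] rm rz.
have B0 : (truncated_binomial R r m.+1).[z] = 0 by apply/rootP.
rewrite leNgt; apply/negP => yz.
have z0 : 0 < |[z]| by apply: le_lt_trans yz; exact: normc_ge0.
have := @truncated_binomial_approx R r m z rm (ltW yz).
rewrite B0 add0r Normc.normcM normc_nat normcX exprSr mulrA ler_pM2l ?leNgt ?yz //.
by rewrite mulr_gt0 ?exprn_gt0 // ltr0n bin_gt0.
Qed.

Lemma truncated_binomial_left_bounds (R : realType) (r m : nat) (z : R[i]) :
  (r <= m)%N -> |[1 + z]| <= |[z]| ->
  'C(m, r)%:R * |[z]| ^+ r * (|[z]| - |[1 + z]|)
    <= |[(truncated_binomial R r m.+1).[z]]|
    <= 2 * ('C(m, r)%:R * |[z]| ^+ r.+1).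
Proof.
move=> rm yz; have := truncated_binomial_approx rm yz.
set B := _.[z]; set w := _%:R * z ^+ _ => Bw.
have wE : |[w]| = 'C(m, r)%:R * |[z]| ^+ r * |[z]|.
  by rewrite Normc.normcM normcX normc_nat exprSr mulrA.
have a0 : 0 <= 'C(m, r)%:R * |[z]| ^+ r.
  by rewrite mulr_ge0 ?exprn_ge0 ?normc_ge0.
have le2 := ler_wpM2l a0 yz.
have b1 := ler_normcB w (- B).
have b2 := ler_normcB B (- w).
rewrite !opprK !normcN [w + B]addrC wE in b1 b2.
rewrite exprSr ['C(m, r)%:R * (_ * _)]mulrA mulrBr.
by apply/andP; split; lra.
Qed.

(** In the terms [k > r] of the full expansion, [rho ^+ k <= rho ^+ r], and [|1 + z|^k] is raised to
    [|1 + z|^n] at the cost of [2 ^+ (n - r)], because [2 |1 + z| >= 1]. *)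
Lemma truncated_binomial_tail (R : realType) (rho : R) (r n : nat) (z : R[i]) :
  (r <= n)%N -> 0 <= rho <= 1 -> |[z]| <= rho * |[1 + z]| ->
  |[(1 + z) ^+ n - (truncated_binomial R r n).[z]]| <=
  |[1 + z]| ^+ n *
    (2 ^+ (n - r) * rho ^+ r * (\sum_(r.+1 <= k < n.+1) 'C(n, k))%:R).
Proof.
move=> rn /andP[rho0 rho1] zy; set y := |[1 + z]| in zy *.
have y0 : 0 <= y by exact: normc_ge0.
(* Here [1 = |(1 + z) - z| <= y + |z| <= 2 * y]. *)
have y2 : 1 <= 2 * y.
  have := ler_normcB (1 + z) z; have := ler_normcD (1 + z) (- z).
  rewrite addrK normcN Normc.normc1 -/y.
  have := ler_wpM2r y0 rho1; lra.
have -> : (1 + z) ^+ n - (truncated_binomial R r n).[z] =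
    \sum_(r.+1 <= k < n.+1) 'C(n, k)%:R * z ^+ k.
  have -> : (1 + z) ^+ n = \sum_(0 <= k < n.+1) 'C(n, k)%:R * z ^+ k.
    rewrite exprDn big_mkord; apply: eq_bigr => i _.
    by rewrite expr1n mul1r mulr_natl.
  rewrite horner_truncated_binomial [X in X - _](@big_cat_nat _ _ _ r.+1) //=.
  by rewrite addrAC subrr add0r.
apply: le_trans (ler_normc_sum _ _) _.
rewrite natr_sum !mulr_sumr big_nat_cond [leRHS]big_nat_cond.
apply: ler_sum => k /andP[/andP[rk kn] _].
rewrite Normc.normcM normc_nat normcX !mulrA mulrC ler_wpM2r ?ler0n //.
apply: (@le_trans _ _ ((rho * y) ^+ k)).
  by apply: lerXn2r; rewrite ?nnegrE ?normc_ge0 // mulr_ge0.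
rewrite exprMn mulrC ler_pM ?exprn_ge0 //; last first.
  by apply: ler_wiXn2l => //; exact: ltnW.
apply: (@le_trans _ _ (y ^+ k * (2 * y) ^+ (n - k))).
  by rewrite ler_peMr ?exprn_ge0 // exprn_ege1.
rewrite exprMn mulrCA -exprD subnKC // mulrC ler_wpM2l ?exprn_ge0 //.
by rewrite ler_eXn2l ?ltr1n // leq_sub2l // ltnW.
Qed.

Lemma truncated_binomial_right_bound (R : realType) (rho : R) :
  rho < 1 ->
  exists m N : nat, forall r n : nat, (r <= n)%N -> (m * (n - r) <= n)%N ->
    (N <= n)%N -> forall z : R[i], |[z]| <= rho * |[1 + z]| ->
    0 < |[1 + z]| ^+ n / 2 <= |[(truncated_binomial R r n).[z]]|.
Proof.
(* [rho] itself may be zero or negative, but the argument divides by it. *)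
move=> rho_lt1; pose s := Num.max rho (1 / 2).
have s0 : 0 < s by rewrite lt_max; apply/orP; right; lra.
have s1 : s < 1 by rewrite gt_max rho_lt1 /=; lra.
have rs : rho <= s by rewrite le_max lexx.
have L1 : 1 <= 2 / s by rewrite ler_pdivlMr //; lra.
have lam1 : 1 < s^-1 by rewrite invf_gt1.
(* With [L = 2 / s] and [lam = s^-1], multiplying by [s ^+ n] recovers the factor
   [2 ^+ (n - r) * s ^+ r] of the tail estimate; [K = 2] makes the relative error at most
   [1 / 2]. *)
have [m [N H]] := binomial_tail_subexponential (ler0n R 2) L1 lam1.
exists m, N => r n rn mn Nn z zy.
have {}zy : |[z]| <= s * |[1 + z]|.
  by apply: le_trans zy _; rewrite ler_wpM2r ?normc_ge0.
have y0 : 0 < |[1 + z]|.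
  rewrite lt_neqAle normc_ge0 andbT eq_sym; apply/eqP => y0.
  move: zy; rewrite y0 mulr0 => z0.
  have := ler_normcD (1 + z) (- z); rewrite addrK normcN Normc.normc1; lra.
have s01 : 0 <= s <= 1 by rewrite !ltW.
have yn0 : 0 < |[1 + z]| ^+ n by rewrite exprn_gt0.
have := truncated_binomial_tail rn s01 zy.
have {H} := H r n rn mn Nn; set T := (\sum_(_ <= k < _) _)%:R => H.
have {}H : 2 ^+ (n - r) * s ^+ r * T <= 1 / 2.
  have sn0 : 0 < s ^+ n by rewrite exprn_gt0.
  move: H; rewrite exprVn -(ltr_pM2r sn0) mulVf ?gt_eqF //.
  have -> : 2 * (2 / s) ^+ (n - r) * T * s ^+ n =
      2 * (2 ^+ (n - r) * s ^+ r * T).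
    have -> : s ^+ n = s ^+ (n - r) * s ^+ r by rewrite -exprD subnK.
    by rewrite expr_div_n; field; rewrite expf_neq0 // gt_eqF.
  lra.
have := ler_normcB ((1 + z) ^+ n) ((1 + z) ^+ n - (truncated_binomial R r n).[z]).
rewrite subKr normcX => b1 b2.
by have := ler_wpM2l (ltW yn0) H; lra.
Qed.

(** * Existence of zeros near each point of the line *)

(** Root by root, [(c + h - a) (c - h - a) = (c - a)^2 - h^2], whose modulus is at most
    [|c - a|^2 (1 + |h|^2 / delta^2)]. *)
Lemma horner_symmetric_bound (R : realType) (p : {poly R[i]}) (c h : R[i])
    (delta : R) :
  0 < delta -> (forall a, root p a -> delta <= |[c - a]|) ->
  |[p.[c + h]]| * |[p.[c - h]]| <=
  |[p.[c]]| ^+ 2 * (1 + |[h]| ^+ 2 / delta ^+ 2) ^+ (size p).-1.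
Proof.
move=> d0 pd; have [->|p0] := eqVneq p 0.
  by rewrite !horner0 Normc.normc0 mul0r expr0n mul0r.
have [s ps] := closed_field_poly_normal p.
have sz : (size p).-1 = size s.
  by rewrite ps size_scale ?lead_coef_eq0 // size_prod_XsubC.
have roots a : a \in s -> delta <= |[c - a]|.
  move=> sa; apply: pd; rewrite ps rootZ ?lead_coef_eq0 //.
  by rewrite root_prod_XsubC.
rewrite sz {1 2 3}ps; move: (lead_coef p) => l.
rewrite !hornerZ !Normc.normcM.
suff : |[(\prod_(z <- s) ('X - z%:P)).[c + h]]| *
    |[(\prod_(z <- s) ('X - z%:P)).[c - h]]| <=
    |[(\prod_(z <- s) ('X - z%:P)).[c]]| ^+ 2 *
    (1 + |[h]| ^+ 2 / delta ^+ 2) ^+ size s.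
  set P := |[_.[c]]|; set P1 := |[_.[c + h]]|; set P2 := |[_.[c - h]]|.
  move=> /(ler_wpM2l (sqr_ge0 |[l]|)).
  have -> : |[l]| ^+ 2 * (P1 * P2) = |[l]| * P1 * (|[l]| * P2) by ring.
  by rewrite exprMn -[_ ^+ 2 * _ * _]mulrA.
move: roots; clear -d0; elim: s => [|a s IH] sd.
  by rewrite !big_nil !hornerC Normc.normc1 expr1n !mul1r expr0.
rewrite !big_cons !hornerM !Normc.normcM !hornerXsubC /=.
have {}IH := IH (fun b bs => sd b (mem_behead (s := a :: s) bs)).
have ad : delta <= |[c - a]| by apply: sd; rewrite mem_head.
set P1 := |[_.[c + h]]| in IH *; set P2 := |[_.[c - h]]| in IH *.
set P := |[_.[c]]| in IH *; set q := 1 + _ in IH *.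
rewrite [q ^+ _]exprS.
have key : |[c + h - a]| * |[c - h - a]| <= |[c - a]| ^+ 2 * q.
  rewrite -Normc.normcM.
  have -> : (c + h - a) * (c - h - a) = (c - a) ^+ 2 - h ^+ 2 by ring.
  apply: le_trans (ler_normcD _ _) _; rewrite normcN !normcX /q mulrDr mulr1.
  rewrite lerD2l mulrCA ler_peMr ?exprn_ge0 ?normc_ge0 //.
  by rewrite ler_pdivlMr ?exprn_gt0 // mul1r lerXn2r ?nnegrE ?normc_ge0 // ltW.
have -> : |[c + h - a]| * P1 * (|[c - h - a]| * P2) =
  |[c + h - a]| * |[c - h - a]| * (P1 * P2) by ring.
have -> : (|[c - a]| * P) ^+ 2 * (q * q ^+ size s) =
  |[c - a]| ^+ 2 * q * (P ^+ 2 * q ^+ size s) by ring.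
by apply: ler_pM => //; rewrite mulr_ge0 ?normc_ge0.
Qed.

Lemma size_truncated_binomial (R : realType) (r n : nat) :
  (size (truncated_binomial R r n) <= r.+1)%N.
Proof.
rewrite /truncated_binomial big_mkord; apply: leq_trans (size_sum _ _ _) _.
apply/bigmax_leqP => i _; apply: leq_trans (size_scale_leq _ _) _.
by rewrite size_polyXn.
Qed.

(** Rearranges the comparison of values at [c + h], [c - h] and [c] into exponential growth with
    base [lam = A^2 / (C^2 q)], where [d + r] is the exponent [n]. The hypothesis amounts to
    [lam^r A^d <= 8 C^2 / kappa * a]. *)
Lemma product_bound_growth (R : realType) (A C q kappa a : R) (d r : nat) :
  1 / 2 <= C -> C <= A -> 0 < q -> 0 < kappa -> 0 < a ->
  A ^+ (d + r) / 2 * (a * A ^+ r * kappa) <= (2 * (a * C ^+ r.+1)) ^+ 2 * q ^+ r ->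
  (A ^+ 2 / (C ^+ 2 * q)) ^+ (d + r) <=
    8 * C ^+ 2 / kappa * (2 * (A ^+ 2 / (C ^+ 2 * q))) ^+ d * a.
Proof.
move=> C2 CA q0 k0 a0; have C0 : 0 < C by lra.
have A0 : 0 < A by lra.
have lam0 : 0 < A ^+ 2 / (C ^+ 2 * q) by rewrite divr_gt0 ?mulr_gt0 ?exprn_gt0.
have lamr : (A ^+ 2 / (C ^+ 2 * q)) ^+ r =
    (A ^+ r) ^+ 2 / ((C ^+ r) ^+ 2 * q ^+ r).
  by rewrite expr_div_n [(C ^+ 2 * q) ^+ r]exprMn !(exprAC _ 2 r).
have U0 : 0 < A ^+ r by rewrite exprn_gt0.
have V0 : 0 < C ^+ r by rewrite exprn_gt0.
have W0 : 0 < q ^+ r by rewrite exprn_gt0.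
have D0 : 0 < A ^+ d by rewrite exprn_gt0.
(* As [A >= 1 / 2], the extra [2 ^+ d] in the conclusion pays for dropping [A ^+ d]. *)
have AD : 1 <= 2 ^+ d * A ^+ d by rewrite -exprMn exprn_ege1 //; lra.
move: lam0 lamr; set lam := A ^+ 2 / _ => lam0 lamr.
rewrite (exprD A) (exprD lam) lamr (exprSr C) [(2 * lam) ^+ d]exprMn.
have := exprn_gt0 d lam0.
move: (_ ^+ d) (2 ^+ d) (A ^+ r) (C ^+ r) (q ^+ r) (A ^+ d) U0 V0 W0 D0 AD.
move=> L E U V W D U0 V0 W0 D0 ED L0 H.
have {}H : U ^+ 2 / (V ^+ 2 * W) * D <= 8 * C ^+ 2 / kappa * a.
  have p0 : 0 < a * kappa / 2 * (V ^+ 2 * W).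
    by rewrite !mulr_gt0 ?invr_gt0 ?exprn_gt0.
  rewrite -(ler_pM2r p0).
  move: H. congr (_ <= _); field; rewrite ?gt_eqF //.
rewrite [leRHS](_ : _ = L * E * (8 * C ^+ 2 / kappa * a)); last by ring.
have E0 : 0 <= E.
  by rewrite -(pmulr_lge0 _ D0); lra.
have LE0 : 0 <= L * E by rewrite mulr_ge0 // ltW.
apply: le_trans (ler_wpM2l LE0 H).
have x0 : 0 < U ^+ 2 / (V ^+ 2 * W) by rewrite divr_gt0 ?mulr_gt0 ?exprn_gt0.
rewrite [leRHS](_ : _ = L * (U ^+ 2 / (V ^+ 2 * W)) * (E * D)); last by ring.
by rewrite ler_peMr // mulr_ge0 ?ltW.
Qed.

(** If every root were at distance at least [delta] from [c], the lower bounds at [c + h] and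
    [c - h] and the upper bound at [c] would give [lam^n <= K (2 lam)^(n-r) 'C(n-1, r)] with
    [lam > 1], against the subexponential tail. *)
Lemma truncated_binomial_zero_near (R : realType) (c : R[i]) (delta : R) :
  complex.Re c = - (1 / 2) -> 0 < delta ->
  exists m N : nat, forall r n : nat, (r < n)%N -> (m * (n - r) <= n)%N ->
    (N <= n)%N ->
    exists2 a : R[i], root (truncated_binomial R r n) a & |[c - a]| < delta.
Proof.
move=> cE d0.
have C2E := sqr_normcE c; rewrite cE in C2E.
set C := |[c]| in C2E *.
have C0 : 0 <= C by exact: normc_ge0.
have C2 : 1 / 2 <= C.
  rewrite -(ler_pXn2r (n := 2)) ?nnegrE //.
  by rewrite C2E; have := sqr_ge0 (complex.Im c); lra.
have Cpos : 0 < C by lra.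
have C20 : 0 < C ^+ 2 by rewrite exprn_gt0.
(* The factor 2 makes the gain [h / |c|^2] beat the loss [h^2 / delta^2]. *)
pose h := delta ^+ 2 / (2 * C ^+ 2).
have h0 : 0 < h by rewrite divr_gt0 ?mulr_gt0 ?exprn_gt0.
pose hc : R[i] := Complex h 0.
have hcE : |[hc]| = h by rewrite /= expr0n addr0 sqrtr_sqr gtr0_norm.
pose q := 1 + h ^+ 2 / delta ^+ 2.
have qE : C ^+ 2 * q = C ^+ 2 + h / 2.
  rewrite /q /h; field; rewrite !gt_eqF //; lra.
have q0 : 0 < q by rewrite ltr_wpDr // divr_ge0 ?sqr_ge0.
set A := |[c - hc]|; set A0 := |[c + hc]|.
have A2E : A ^+ 2 = C ^+ 2 + h + h ^+ 2.
  rewrite sqr_normcE C2E /hc; case: (c) cE => x y /= ->; lra.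
have A02E : A0 ^+ 2 = C ^+ 2 - h + h ^+ 2.
  rewrite sqr_normcE C2E /hc; case: (c) cE => x y /= ->; lra.
(* Reflection in the line exchanges [c + hc] and [c - hc], and exchanges the distances to [0] and
   [-1]. *)
have y1 : |[1 + (c + hc)]| = A.
  by apply: normc_eq; rewrite !sqr_normcE /hc; case: (c) cE => x y /= ->; lra.
have y2 : |[1 + (c - hc)]| = A0.
  by apply: normc_eq; rewrite !sqr_normcE /hc; case: (c) cE => x y /= ->; lra.
have yc : |[1 + c]| = C.
  by apply: normc_eq; rewrite !sqr_normcE /hc; case: (c) cE => x y /= ->; lra.
have Age0 : 0 <= A by exact: normc_ge0.
have A0ge0 : 0 <= A0 by exact: normc_ge0.
have A0A : A0 < A.
  by rewrite -(ltr_pXn2r (n := 2)) ?nnegrE // A2E A02E; lra.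
have CA : C <= A.
  by rewrite -(ler_pXn2r (n := 2)) ?nnegrE // A2E; have := sqr_ge0 h; lra.
have Apos : 0 < A by lra.
have rho1 : A0 / A < 1 by rewrite ltr_pdivrMr // mul1r.
pose lam := A ^+ 2 / (C ^+ 2 * q).
(* Gain against loss: [A^2 = C^2 + h + h^2], while [C^2 q] is only [C^2 + h / 2]. *)
have lam1 : 1 < lam.
  rewrite ltr_pdivlMr ?mulr_gt0 // mul1r qE A2E.
  by have := sqr_ge0 h; lra.
have k0 : 0 < A - A0 by lra.
have K0 : 0 <= 8 * C ^+ 2 / (A - A0) by rewrite divr_ge0 ?mulr_ge0 // ltW.
have L1 : 1 <= 2 * lam by lra.
have [m1 [N1 H1]] := truncated_binomial_right_bound rho1.
have [m2 [N2 H2]] := binomial_tail_subexponential K0 L1 lam1.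
exists (maxn m1 m2), (maxn N1 N2) => r n rn mn Nn.
have rn' := ltnW rn.
have mn1 : (m1 * (n - r) <= n)%N.
  by apply: leq_trans mn; rewrite leq_mul2r leq_maxl orbT.
have mn2 : (m2 * (n - r) <= n)%N.
  by apply: leq_trans mn; rewrite leq_mul2r leq_maxr orbT.
move: Nn; rewrite geq_max => /andP[Nn1 Nn2].
apply: contrapT => noroot.
have far a : root (truncated_binomial R r n) a -> delta <= |[c - a]|.
  by move=> ra; rewrite leNgt; apply/negP => ca; apply: noroot; exists a.
have prod := horner_symmetric_bound hc d0 far.
have right : 0 < A ^+ n / 2 <= |[(truncated_binomial R r n).[c + hc]]|.
  rewrite -y1; apply: (H1 _ _ rn' mn1 Nn1).
  by rewrite y1 divfK ?gt_eqF.
have := H2 _ _ rn' mn2 Nn2; apply/negP; rewrite -leNgt.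
case: n rn rn' mn mn1 mn2 Nn1 Nn2 noroot far prod right => // s rn rn' _ _ _ _ _.
move=> _ _ prod /andP[right0 right].
have rs : (r <= s)%N by [].
have left : |[1 + (c - hc)]| <= |[c - hc]| by rewrite y2 ltW.
have /andP[{}left _] := truncated_binomial_left_bounds rs left.
have mid : |[1 + c]| <= |[c]| by rewrite yc.
have /andP[_ {}mid] := truncated_binomial_left_bounds rs mid.
rewrite y2 -/A in left; rewrite -/C in mid; rewrite hcE -/q in prod.
have a0 : 0 < 'C(s, r)%:R :> R by rewrite ltr0n bin_gt0.
(* Already the first tail term ['C(s.+1, r.+1)] dominates ['C(s, r)]. *)
have aT : 'C(s, r)%:R <= (\sum_(r.+1 <= k < s.+2) 'C(s.+1, k))%:R :> R.
  rewrite ler_nat big_ltn ?ltnS // binS.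
  by apply: leq_trans (leq_addr _ _); exact: leq_addl.
have q1 : 1 <= q by rewrite lerDl divr_ge0 ?sqr_ge0.
have main : A ^+ s.+1 / 2 * ('C(s, r)%:R * A ^+ r * (A - A0)) <=
    (2 * ('C(s, r)%:R * C ^+ r.+1)) ^+ 2 * q ^+ r.
  apply: (@le_trans _ _ (|[(truncated_binomial R r s.+1).[c + hc]]| *
                         |[(truncated_binomial R r s.+1).[c - hc]]|)).
    apply: (ler_pM (ltW right0) _ right left).
    by rewrite !mulr_ge0 ?exprn_ge0 // ?ler0n // ltW.
  apply: le_trans prod _; apply: ler_pM.
  - exact: sqr_ge0.
  - by rewrite exprn_ge0 // ltW.
  - by apply: lerXn2r; rewrite ?nnegrE ?normc_ge0 // !mulr_ge0 ?exprn_ge0 ?ler0n.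
  - apply: ler_weXn2l => //.
    by have := size_truncated_binomial R r s.+1; case: (size _).
have := @product_bound_growth R A C q (A - A0) 'C(s, r)%:R (s.+1 - r) r
          C2 CA q0 k0 a0.
rewrite subnK // -/lam => /(_ main) growth.
apply: le_trans growth _; apply: ler_wpM2l aT.
exact: mulr_ge0 K0 (exprn_ge0 _ (le_trans ler01 L1)).
Qed.

(** * Convergence and limit points of zeros *)

Lemma cvg_normcP (R : realType) (z : nat -> R[i]) (l : R[i]) :
  z @ \oo --> (l : R[i]^o) <->
  forall e : R, 0 < e ->
    exists N : nat, forall i : nat, (N <= i)%N -> |[l - z i]| < e.
Proof.
split=> [/(@cvgrPdist_lt _ R[i]^o) zl e e0|zl].
  have /zl [N _ HN] : (0 : R[i]) < (e%:C)%C by rewrite ltcR.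
  exists N => i Ni; have := HN i Ni.
  by rewrite /= -ltcR.
(* The radius is a positive element of [R[i]], which forces its imaginary part to vanish. *)
apply/(@cvgrPdist_lt _ R[i]^o) => -[e e'] /=; rewrite ltcE /= => /andP[/eqP -> e0].
have [N HN] := zl e e0; exists N => // i Ni.
have := HN i Ni; rewrite -ltcR; exact.
Qed.

Lemma ratio_cvg1_balanced (R : realType) (r n : nat -> nat) :
  (forall j, (r j < n j)%N) -> r @ \oo --> \oo ->
  (fun j => (r j)%:R / (n j)%:R : R) @ \oo --> (1 : R) ->
  forall m N : nat, exists J : nat, forall j : nat, (J <= j)%N ->
    (m * (n j - r j) <= n j)%N /\ (N <= n j)%N.
Proof.
move=> rn /cvgnyPge hr /cvgrPdist_lt hlim m N.
have [J1 _ H1] := hr N.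
(* From [1 - r / n < 1 / (m + 1)] follows [(m + 1) (n - r) < n]; the successor covers [m = 0]. *)
have m0 : 0 < m.+1%:R^-1 :> R by rewrite invr_gt0 ltr0n.
have [J2 _ H2] := hlim _ m0.
exists (maxn J1 J2) => j; rewrite geq_max => /andP[j1 j2]; split; last first.
  exact: leq_trans (H1 j j1) (ltnW (rn j)).
have n0 : 0 < (n j)%:R :> R by rewrite ltr0n (leq_ltn_trans _ (rn j)).
have := le_lt_trans (ler_norm _) (H2 j j2).
rewrite -(ltr_pM2r n0) mulrBl mul1r divfK ?gt_eqF // mulrC ltr_pdivlMr ?ltr0n //.
rewrite -natrB ?(ltnW (rn j)) // -natrM ltr_nat mulnC => H.
by apply: leq_trans (ltnW H); rewrite leq_mul2r leqnSn orbT.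
Qed.

Lemma normc_equidistant (R : rcfType) (z : R[i]) :
  |[z]| = |[1 + z]| -> complex.Re z = - (1 / 2).
Proof.
move=> /(congr1 (fun x => x ^+ 2)); rewrite /= !sqr_normcE.
by case: z => x y /=; nra.
Qed.

Lemma zeros_limit_point_on_line (R : realType) (r n : nat -> nat) :
  (forall j, (r j < n j)%N) ->
  (forall m N : nat, exists J : nat, forall j : nat, (J <= j)%N ->
    (m * (n j - r j) <= n j)%N /\ (N <= n j)%N) ->
  zeros_limit_points (fun j => truncated_binomial R (r j) (n j)) `<=`
  [set zeta : R[i] | complex.Re zeta = - (1 / 2)].
Proof.
move=> rn bal zeta [j [z [jmono zroot /cvg_normcP zcvg]]] /=.
have jge i : (i <= j i)%N.
  elim: i => // i IH; apply: leq_ltn_trans IH _; exact: jmono.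
have near i : |[z i]| <= |[zeta]| + |[zeta - z i]| /\
    |[zeta]| <= |[z i]| + |[zeta - z i]| /\
    |[1 + z i]| <= |[1 + zeta]| + |[zeta - z i]| /\
    |[1 + zeta]| <= |[1 + z i]| + |[zeta - z i]|.
  have := ler_normcB (z i) zeta; have := ler_normcB zeta (z i).
  have := ler_normcB (1 + z i) (1 + zeta); have := ler_normcB (1 + zeta) (1 + z i).
  have -> : 1 + z i - (1 + zeta) = z i - zeta by ring.
  have -> : 1 + zeta - (1 + z i) = zeta - z i by ring.
  rewrite (normcB_sym (z i)).
  by move=> *; split; [|split; [|split]]; lra.
apply: normc_equidistant; apply: le_anti; apply/andP.
split; rewrite leNgt; apply/negP => lt.
- have e0 : 0 < (|[zeta]| - |[1 + zeta]|) / 3 by lra.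
  have [i Hi] := zcvg _ e0; have {}Hi := Hi i (leqnn i).
  have := truncated_binomial_root (rn _) (zroot i).
  by have := near i; lra.
- pose g := |[1 + zeta]| - |[zeta]|; have g0 : 0 < g / 4 by rewrite /g; lra.
  have X0 := normc_ge0 zeta.
  have Y0 : 0 < |[1 + zeta]| - g / 4 by rewrite /g; lra.
  (* A single ratio below 1 that serves every zero within [g / 4] of [zeta], so the threshold of
     [truncated_binomial_right_bound] is uniform. *)
  pose rho := (|[zeta]| + g / 4) / (|[1 + zeta]| - g / 4).
  have rho0 : 0 <= rho by rewrite divr_ge0 ?ltW //; lra.
  have rho1 : rho < 1 by rewrite ltr_pdivrMr // mul1r /g; lra.
  have [m [N H]] := truncated_binomial_right_bound rho1.
  have [J HJ] := bal m N; have [I HI] := zcvg _ g0.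
  set i := maxn I J; have [mn Nn] := HJ (j i) (leq_trans (leq_maxr I J) (jge i)).
  have zi := HI i (leq_maxl I J).
  have := H _ _ (ltnW (rn (j i))) mn Nn (z i).
  have /rootP -> := zroot i; rewrite Normc.normc0.
  have [n1 [_ [_ n4]]] := near i.
  have zy : |[z i]| <= rho * |[1 + z i]|.
    apply: (@le_trans _ _ (rho * (|[1 + zeta]| - g / 4))).
      by rewrite divfK ?gt_eqF //; lra.
    by rewrite ler_wpM2l //; lra.
  by move=> /(_ zy) /andP[p q]; have := lt_le_trans p q; rewrite ltxx.
Qed.

Theorem theorem2p5 (R : realType) (r n : nat -> nat)
    (hrn : forall j : nat, (1 <= r j)%N /\ (r j < n j - 1)%N)
    (hr : r @ \oo --> \oo)
    (hlim : (fun j : nat => (r j)%:R / (n j)%:R : R) @ \oo --> (1 : R)) :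
  zeros_limit_points (fun j : nat => truncated_binomial R (r j) (n j)) =
  [set zeta : R[i] | complex.Re zeta = - (1 / 2)].
Proof.
have rn j : (r j < n j)%N by have [_ h] := hrn j; apply: leq_trans h (leq_subr _ _).
have bal := ratio_cvg1_balanced rn hr hlim.
apply/seteqP; split; first exact: zeros_limit_point_on_line.
move=> zeta /= zetaE.
have /choice[J HJ] (k : nat) : exists J : nat, forall j : nat, (J <= j)%N ->
    exists2 a : R[i], root (truncated_binomial R (r j) (n j)) a &
      |[zeta - a]| < k.+1%:R^-1.
  have k0 : 0 < k.+1%:R^-1 :> R by rewrite invr_gt0 ltr0n.
  have [m [N H]] := truncated_binomial_zero_near zetaE k0.
  by have [J HJ] := bal m N; exists J => j /HJ[mn Nn]; exact: H.
(* The maximum keeps the indices strictly increasing and past the threshold [J k] for radius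
   [1 / (k + 1)]. *)
pose j := fix j k := if k is k'.+1 then maxn (j k').+1 (J k) else J 0%N.
have Jj k : (J k <= j k)%N by case: k => [|k] //=; rewrite leq_maxr.
have /choice[z Hz] (k : nat) : exists a : R[i],
    root (truncated_binomial R (r (j k)) (n (j k))) a /\
    |[zeta - a]| < k.+1%:R^-1.
  by have [a] := HJ k (j k) (Jj k); exists a.
exists j, z; split.
- apply: homo_ltn => [a b c|k /=]; first exact: ltn_trans.
  by rewrite leq_maxl.
- by move=> k; have [] := Hz k.
- apply/cvg_normcP => e e0; exists (Num.Def.archi_bound e^-1) => i ie.
  have [_ h] := Hz i; apply: lt_le_trans h _.
  rewrite -[leRHS]invrK lef_pV2 ?posrE ?invr_gt0 ?ltr0n //.
  apply: ltW; apply: lt_le_trans (archi_boundP _) _; first by rewrite invr_ge0 ltW.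
  by rewrite ler_nat; apply: leqW.
Qed.
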